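(* Let $t$ be a positive integer and let $A$ be an EW tournament matrix of order $4t+1$. Then the Smith normal form of $A$ is \[ \operatorname{diag}[\underbrace{1,\dots,1}_{2t+2},\underbrace{t,\dots,t}_{2t-2},t^2(4t-1)]. \]
   Context: A tournament matrix is a $\{0,1\}$-matrix $A$ with $A+A^\top=J-I$, where $J$ is the all-ones matrix and $I$ the identity. A tournament matrix $A$ of order $4t+1$ is called an EW tournament matrix if there is an integer $a$ with $0\le a\le 2t+1$ such that, writing matrices in block form with respect to the partition of the index set $\{1,\dots,4t+1\}$ into consecutive blocks of sizes $t,t,a,2t+1-a$, \[ AA^\top=t(I_{4t+1}+J_{4t+1})+\begin{pmatrix}-J_t & -J & -J & -J\\ -J & J_t & O & O\\ -J & O & O_a & -J\\ -J & O & -J & O_{2t+1-a}\end{pmatrix}, \] \[ A^\top A=t(I_{4t+1}+J_{4t+1})+\begin{pmatrix}J_t & -J & O & O\\ -J & -J_t & -J & -J\\ O & -J & J_a & O\\ O & -J & O & -J_{2t+1-a}\end{pmatrix}, \] where $J$ and $O$ denote all-ones and all-zeros blocks of the appropriate sizes. Every $n\times n$ integer matrix $M$ is equivalent (via $M\mapsto PMQ$ with $P,Q$ unimodular integer matrices) to a unique diagonal matrix $\operatorname{diag}[m_1,\dots,m_n]$ with nonnegative integers $m_i$, $m_i\mid m_{i+1}$; this is the Smith normal form of $M$.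
   Formalization: The lower right 2x2 block corner of the AᵀA condition is taken as [O, -J; -J, O] instead of the printed [J_a, O; O, -J]; with the printed corner no tournament matrix satisfies the definition, and the corrected corner is forced by the AAᵀ condition. *)

(* Defs.v *)
From mathcomp Require Import all_boot all_order all_algebra.
From mathcomp Require Import ring.

Set Implicit Arguments.
Unset Strict Implicit.
Unset Printing Implicit Defensive.

Import GRing.Theory Num.Theory.
Local Open Scope ring_scope.

Definition allones {m n : nat} : 'M[int]_(m, n) := const_mx 1.

Definition is_tournament_mx (n : nat) (A : 'M[int]_n) : Prop :=
  (forall i j, A i j \in [:: 0; 1]) /\ A + A^T = allones - 1%:M.

(* Position (0, 1, 2 or 3) of the block containing i, when {0, ..., 4t} is cut *)
(* into consecutive blocks of sizes t, t, a, 2t + 1 - a.                       *)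
Definition ew_block (t a i : nat) : nat :=
  if (i < t)%N then 0%N
  else if (i < t + t)%N then 1%N
  else if (i < t + t + a)%N then 2%N
  else 3%N.

(* All blocks occurring in the definition of an EW matrix are constant, so a   *)
(* block matrix is given by the 4 x 4 table C of the values of its blocks.     *)
Definition ew_block_mx (t a : nat) (C : seq (seq int)) : 'M[int]_(4 * t + 1) :=
  \matrix_(i, j) (nth [::] C (ew_block t a i))`_(ew_block t a j).

Definition ew_rows : seq (seq int) :=
  [:: [:: -1; -1; -1; -1];
      [:: -1;  1;  0;  0];
      [:: -1;  0;  0; -1];
      [:: -1;  0; -1;  0]].

(* The source prints the lower right 2 x 2 corner as [J, O; O, -J].  This is a *)
(* misprint: A^T *m A is determined by A *m A^T for a tournament matrix A, and *)
(* the corner must be [O, -J; -J, O] (ew_cols_forced below); with the printed  *)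
(* corner no matrix would satisfy the definition (ew_cols_printed_absurd).     *)
Definition ew_cols : seq (seq int) :=
  [:: [::  1; -1;  0;  0];
      [:: -1; -1; -1; -1];
      [::  0; -1;  0; -1];
      [::  0; -1; -1;  0]].

Definition ew_cols_printed : seq (seq int) :=
  [:: [::  1; -1;  0;  0];
      [:: -1; -1; -1; -1];
      [::  0; -1;  1;  0];
      [::  0; -1;  0; -1]].

Definition is_EW_tournament_mx (t : nat) (A : 'M[int]_(4 * t + 1)) : Prop :=
  is_tournament_mx A /\
  exists a : nat,
    [/\ (a <= 2 * t + 1)%N,
        A *m A^T = t%:Z *: (1%:M + allones) + ew_block_mx t a ew_rows
      & A^T *m A = t%:Z *: (1%:M + allones) + ew_block_mx t a ew_cols].

(* Over int, membership in unitmx means determinant 1 or -1. *)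
Definition is_Smith_normal_form (n : nat) (M D : 'M[int]_n) : Prop :=
  [/\ is_diag_mx D,
      forall i, 0 <= D i i,
      forall i j : 'I_n, j = i.+1 :> nat -> (D i i %| D j j)%Z
    & exists P Q : 'M[int]_n,
        [/\ P \in unitmx, Q \in unitmx & P *m M *m Q = D]].

Definition diag_of_seq (n : nat) (s : seq int) : 'M[int]_n :=
  diag_mx (\row_(i < n) s`_i).

Lemma ew_cols_forced (t a : nat) (A : 'M[int]_(4 * t + 1)) :
  is_tournament_mx A ->
  A *m A^T = t%:Z *: (1%:M + allones) + ew_block_mx t a ew_rows ->
  A^T *m A = t%:Z *: (1%:M + allones) + ew_block_mx t a ew_cols.
Proof.
move=> [A01 AT] AAT.
have defAT : A^T = allones - 1%:M - A by rewrite -AT addrC addKr.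
have rowS i : (A *m allones) i i = 2 * t%:Z + (ew_block_mx t a ew_rows) i i.
  have -> : (A *m (allones : 'M_(4 * t + 1))) i i = (A *m A^T) i i.
    rewrite !mxE; apply: eq_bigr => k _; rewrite !mxE mulr1.
    by have := A01 i k; rewrite !inE => /orP[] /eqP ->.
  by rewrite AAT !mxE eqxx; congr (_ + _); rewrite mulrC.
have colS i :
    (allones *m A) i i = 4 * t%:Z - (A *m (allones : 'M_(4 * t + 1))) i i.
  have: ((allones : 'M_(4 * t + 1)) *m (A + A^T)) i i = 4 * t%:Z.
    rewrite AT mulmxBr mulmx1 !mxE.
    under eq_bigr do rewrite !mxE mulr1.
    rewrite sumr_const card_ord natrD natrM addrK.
    by rewrite -[t%:R]/(t%:R : int) natz.
  rewrite mulmxDr mxE => <-; rewrite [X in _ = _ + X - _]mxE.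
  suff -> : \sum_j (allones : 'M_(4 * t + 1)) i j * A^T j i
          = (A *m (allones : 'M_(4 * t + 1))) i i by rewrite addrK.
  by rewrite [RHS]mxE; apply: eq_bigr => k _; rewrite !mxE mulrC.
have swap : A^T *m A = A *m A^T + allones *m A - A *m allones.
  rewrite defAT !mulmxBl !mulmxBr mul1mx mulmx1.
  by rewrite -[RHS]addrA [RHS]addrC -!addrA; congr (_ + _); rewrite addKr.
apply/matrixP => i j; rewrite swap AAT.
have cj : (allones *m A) i j = (allones *m A) j j.
  by rewrite !mxE; apply: eq_bigr => k _; rewrite !mxE.
have ri : (A *m allones) i j = (A *m (allones : 'M_(4 * t + 1))) i i.
  by rewrite !mxE; apply: eq_bigr => k _; rewrite !mxE.
rewrite [LHS]mxE [X in X + _]mxE [X in _ + X]mxE cj ri colS !rowS.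
rewrite [X in X + _ - _]mxE [RHS]mxE -[LHS]addrA -[LHS]addrA; congr (_ + _).
have arith (x y z u : int) :
    x + (4 * u - (2 * u + y) - (2 * u + z)) = x - y - z by ring.
rewrite arith !mxE /ew_block.
by do 2![case: ifP => _; last (case: ifP => _; last case: ifP => _)].
Qed.

Lemma ew_cols_printed_absurd (t a : nat) (A : 'M[int]_(4 * t + 1)) :
  is_tournament_mx A ->
  A *m A^T = t%:Z *: (1%:M + allones) + ew_block_mx t a ew_rows ->
  A^T *m A <> t%:Z *: (1%:M + allones) + ew_block_mx t a ew_cols_printed.
Proof.
move=> tA AAT; rewrite (ew_cols_forced tA AAT) => /addrI /matrixP.
have lt2t : (t + t < 4 * t + 1)%N.
  by rewrite addn1 ltnS addnn -muln2 mulnC leq_mul2r orbT.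
move=> /(_ (Ordinal lt2t) (Ordinal lt2t)); rewrite !mxE /ew_block /=.
by rewrite ltnn -ltn_subRL subnn ltn0; case: ifP.
Qed.

(* Main.v *)
Require Import Defs.
From mathcomp Require Import all_boot all_order all_algebra.
From mathcomp Require Import ring lra zify.

Set Implicit Arguments.
Unset Strict Implicit.
Unset Printing Implicit Defensive.

Import Order.TTheory GRing.Theory Num.Theory.
Local Open Scope ring_scope.

(** Write A = L D R with D = diag(d_0, d_1, ...) a Smith form, n = 4t+1, and let
    R1, R2 be the rank-three block matrices with A A^T = t(I+J) + R1 and
    A^T A = t(I+J) + R2.

    - Determinant.  With j the all-ones vector, r = A j - 2t j and g = A^T r are
      constant on blocks, and |g|^2 = r^T A A^T r forces (a-t)(a-t-1) = 2t.
      With this relation, det(A A^T) reduces to a 4 x 4 determinant and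
      |det A| = t^(2t) (4t-1).
    - The last but one factor q = d_(n-2) divides t.  A combination of the last two
      rows of L^-1 is an integer vector v with v j = 0 and v A = 0 mod q; then
      v A^T = -v mod q, and comparing v A A^T with v A^T A gives
      (4t+1) t v = 0 mod q.  As q divides det A, it is prime to 4t+1.
    - For a prime p dividing t, A has rank 2t+2 mod p: R1 = A A^T has rank 3, which
      bounds the rank from above; the row spaces of A and A^T both contain that of
      R1 and together they span everything, as I = J - A - A^T.
    - A is von Neumann regular mod t, A Y A = A, so d_i (d_i z_i - 1) = 0 mod t for
      some z_i: a factor d_i divisible by every prime divisor of t is divisible by t.

    Hence d_i = 1 for i < 2t+2, d_i = t for the next 2t-2 factors, up to sign, and
    the determinant gives the last one. *)

(** * Block-constant matrices reduced to 4 x 4 tables *)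

Definition block_ind (t a : nat) : 'M[int]_(4 * t + 1, 4) :=
  \matrix_(i, k) (ew_block t a i == k)%:R.

Definition table_mx {m n : nat} (C : seq (seq int)) : 'M[int]_(m, n) :=
  \matrix_(i, j) (nth [::] C i)`_j.

Definition sizes (t a b : nat) : 'rV[int]_4 :=
  \row_k [:: t%:Z; t%:Z; a%:Z; b%:Z]`_k.

Definition col4 (s : seq int) : 'cV[int]_4 := \col_k s`_k.

Lemma ew_block_lt4 t a i : (ew_block t a i < 4)%N.
Proof. by rewrite /ew_block; do 3![case: ifP => _ //]. Qed.

Lemma sum_blocks (t a b : nat) (f : nat -> int) : (a + b = 2 * t + 1)%N ->
  \sum_(i < 4 * t + 1) f (ew_block t a i)
    = t%:Z * f 0%N + t%:Z * f 1%N + a%:Z * f 2%N + b%:Z * f 3%N.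
Proof.
move=> Hab.
rewrite -(big_mkord xpredT (fun i => f (ew_block t a i))).
have const m k c : (forall i, (m <= i < m + k)%N -> ew_block t a i = c) ->
    \sum_(m <= i < m + k) f (ew_block t a i) = k%:Z * f c.
  move=> H; rewrite (eq_big_nat _ _ (F2 := fun=> f c)).
    by rewrite big_const_nat addKn iter_addr_0 -mulr_natl -[k%:R]/(k%:R : int) natz.
  by move=> i Hi; rewrite H.
rewrite (big_cat_nat (n := t)) //=; last by lia.
rewrite (big_cat_nat (n := (t + t)%N) (m := t)) //=; [|lia|lia].
rewrite (big_cat_nat (n := (t + t + a)%N) (m := (t + t)%N)) //=; [|lia|lia].
have -> : (4 * t + 1 = t + t + a + b)%N by lia.
rewrite (const 0%N t 0%N) ?(const t t 1%N) ?(const (t + t)%N a 2%N).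
  by rewrite (const (t + t + a)%N b 3%N) ?addrA // => i Hi;
    rewrite /ew_block; do 3?[case: ifP => ?; try lia].
all: by move=> i Hi; rewrite /ew_block; do 3?[case: ifP => ?; try lia].
Qed.

Lemma block_ind_mulmx (t a m : nat) (M : 'M[int]_(4, m)) i j :
  (block_ind t a *m M) i j = M (Ordinal (ew_block_lt4 t a i)) j.
Proof.
rewrite mxE (bigD1 (Ordinal (ew_block_lt4 t a i))) //= mxE eqxx mul1r big1 ?addr0 //.
move=> k /negPf Hk; rewrite mxE; case: eqP => [H|_]; last by rewrite mul0r.
by move/eqP: Hk; case; apply: val_inj.
Qed.

Lemma mulmx_block_ind_tr (t a m : nat) (M : 'M[int]_(m, 4)) i j :
  (M *m (block_ind t a)^T) i j = M i (Ordinal (ew_block_lt4 t a j)).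
Proof.
by rewrite -[M]trmxK -trmx_mul mxE block_ind_mulmx [RHS]mxE.
Qed.

Lemma ew_block_mx_table (t a : nat) C :
  ew_block_mx t a C = block_ind t a *m table_mx C *m (block_ind t a)^T.
Proof.
by apply/matrixP => i j; rewrite mulmx_block_ind_tr block_ind_mulmx !mxE.
Qed.

Lemma block_ind_gram (t a b : nat) : (a + b = 2 * t + 1)%N ->
  (block_ind t a)^T *m block_ind t a = diag_mx (sizes t a b).
Proof.
move=> Hab; apply/matrixP => k l; rewrite mxE.
under eq_bigr do rewrite !mxE.
rewrite (sum_blocks (fun x => (x == k)%:R * (x == l)%:R) Hab) !mxE.
by case: k => [[|[|[|[|k]]]] Hk] //; case: l => [[|[|[|[|l]]]] Hl] //;
  rewrite -[_ == _ :> 'I_4]/(_ == _ :> nat) /= ?(mulr0, mulr1, addr0, add0r).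
Qed.

Lemma allones_blocks (t a : nat) :
  (allones : 'M[int]_(4 * t + 1))
    = block_ind t a *m (allones : 'M_4) *m (block_ind t a)^T.
Proof.
by apply/matrixP => i j; rewrite mulmx_block_ind_tr block_ind_mulmx !mxE.
Qed.

(** J is itself block-constant, so the term t J of a Gram matrix is absorbed into the table and only
    the scalar matrix t I stays outside. *)
Definition shifted_table (t : nat) (C : seq (seq int)) : 'M[int]_4 :=
  table_mx C + t%:Z *: allones.

Lemma ew_gram_blocks (t a : nat) C :
  t%:Z *: (1%:M + allones) + ew_block_mx t a C
  = t%:Z%:M + block_ind t a *m shifted_table t C *m (block_ind t a)^T.
Proof.
rewrite ew_block_mx_table (allones_blocks t a) scalerDr scalemx1 -addrA.
by rewrite /shifted_table mulmxDr mulmxDl -scalemxAr -scalemxAl [X in _ + X]addrC.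
Qed.

Lemma const_blocks (t a : nat) :
  (const_mx 1 : 'cV[int]_(4 * t + 1)) = block_ind t a *m const_mx 1.
Proof. by apply/matrixP => i j; rewrite block_ind_mulmx !mxE. Qed.

(** * Row sums and the relation between a and t *)

(** Entries 0 and 1 equal their own squares. *)
Lemma zero_one_row_sum (m n : nat) (A : 'M[int]_(m, n)) i :
  (forall i j, A i j \in [:: 0; 1]) ->
  (A *m (const_mx 1 : 'cV_n)) i 0 = (A *m A^T) i i.
Proof.
move=> A01; rewrite !mxE; apply: eq_bigr => k _; rewrite !mxE mulr1.
by have := A01 i k; rewrite !inE => /orP[] /eqP ->.
Qed.

Lemma zero_one_row_sums (t a : nat) (A : 'M[int]_(4 * t + 1)) C :
  (forall i j, A i j \in [:: 0; 1]) ->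
  A *m A^T = t%:Z *: (1%:M + allones) + ew_block_mx t a C ->
  A *m (const_mx 1 : 'cV_(4 * t + 1))
    = block_ind t a *m col4 [seq 2 * t%:Z + (nth [::] C k)`_k | k <- iota 0 4].
Proof.
move=> A01 AAT; apply/matrixP => i j; rewrite (ord1 j) zero_one_row_sum // AAT.
rewrite block_ind_mulmx !mxE eqxx.
rewrite (nth_map 0%N) ?size_iota ?ew_block_lt4 // nth_iota ?ew_block_lt4 // add0n.
by congr (_ + _); rewrite mulrC.
Qed.

Section EWRelation.
Variables (t a b : nat) (A : 'M[int]_(4 * t + 1)).
Hypothesis t_gt0 : (0 < t)%N.
Hypothesis Hab : (a + b = 2 * t + 1)%N.
Hypothesis tA : is_tournament_mx A.
Hypothesis AAT : A *m A^T = t%:Z *: (1%:M + allones) + ew_block_mx t a ew_rows.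
Hypothesis ATA : A^T *m A = t%:Z *: (1%:M + allones) + ew_block_mx t a ew_cols.
Let E := block_ind t a.

Lemma ew_row_sums : A *m (const_mx 1 : 'cV_(4 * t + 1))
  = E *m col4 [:: 2 * t%:Z - 1; 2 * t%:Z + 1; 2 * t%:Z; 2 * t%:Z].
Proof. by rewrite (zero_one_row_sums tA.1 AAT) /= !addr0. Qed.

Lemma ew_col_sums : A^T *m (const_mx 1 : 'cV_(4 * t + 1))
  = E *m col4 [:: 2 * t%:Z + 1; 2 * t%:Z - 1; 2 * t%:Z; 2 * t%:Z].
Proof.
rewrite (@zero_one_row_sums t a A^T ew_cols) /= ?trmxK ?ATA ?addr0 //.
by move=> i j; rewrite mxE tA.1.
Qed.

(** The vector acted on is r = A j - 2t j, so A^T r = A^T A j - 2t A^T j, where A^T A and the column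
    sums are known. *)
Lemma ew_trmx_mul_diff : A^T *m (E *m col4 [:: -1; 1; 0; 0])
  = E *m col4 [:: 0; -1; t%:Z - b%:Z; t%:Z - a%:Z].
Proof.
have -> : E *m col4 [:: -1; 1; 0; 0]
    = A *m const_mx 1 - (2 * t%:Z) *: const_mx 1.
  rewrite ew_row_sums (const_blocks t a) scalemxAr -mulmxBr.
  by congr (_ *m _); apply/matrixP => -[[|[|[|[|k]]]] Hk] j //; rewrite !mxE /=; ring.
rewrite mulmxBr -scalemxAr ew_col_sums mulmxA ATA ew_gram_blocks.
rewrite (const_blocks t a) mulmxDl -!mulmxA [_^T *m (_ *m _)]mulmxA.
rewrite (block_ind_gram Hab) mul_diag_mx mul_scalar_mx -/E !scalemxAr -mulmxDr -mulmxBr.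
have Hb : b%:Z = 2 * t%:Z + 1 - a%:Z by lia.
congr (_ *m _); apply/matrixP => -[[|[|[|[|k]]]] Hk] j //;
  by rewrite !(mxE, big_ord_recl, big_ord0) /= Hb; ring.
Qed.

Lemma ew_relation : (a%:Z - t%:Z) * (a%:Z - t%:Z - 1) = 2 * t%:Z.
Proof.
set r := E *m col4 [:: -1; 1; 0; 0]; set g := E *m col4 [:: 0; -1; t%:Z - b%:Z; t%:Z - a%:Z].
have gram u v C : (E *m u)^T *m (t%:Z%:M + E *m C *m E^T) *m (E *m v)
    = t%:Z *: (u^T *m (diag_mx (sizes t a b) *m v))
      + (diag_mx (sizes t a b) *m u)^T *m (C *m (diag_mx (sizes t a b) *m v))
    :> 'M[int]_1.
  rewrite mulmxDr mulmxDl mul_mx_scalar -scalemxAl trmx_mul -(block_ind_gram Hab).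
  by rewrite !trmx_mul trmxK !mulmxA.
have : g^T *m g = r^T *m (A *m A^T) *m r.
  by rewrite /g -ew_trmx_mul_diff trmx_mul trmxK !mulmxA.
rewrite AAT ew_gram_blocks gram /g trmx_mul -!mulmxA [E^T *m (_ *m _)]mulmxA.
rewrite (block_ind_gram Hab) !mul_diag_mx => /matrixP/(_ 0 0).
rewrite !(mxE, big_ord_recl, big_ord0) /=.
have -> : b%:Z = 2 * t%:Z + 1 - a%:Z by lia.
(* With [b] eliminated, the norm identity amounts to 2t + (2t - 1)(a - t)(a - t - 1) = 4t^2, which
   is 2t - 1 times the relation. *)
move=> H; apply: (@mulfI _ (2 * t%:Z - 1)); first by lia.
by move: H; move: t%:Z a%:Z => x y; lra.
Qed.
End EWRelation.

(** * The determinant *)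

(** Sylvester's determinant identity, with powers of [c] in place of its inverse. The block matrix
    [M] is made triangular by a column operation, and again by a row operation that multiplies its
    determinant by c^m. *)
Lemma det_scalar_add_mulmx (R : comNzRingType) (m n : nat) (c : R)
    (U : 'M[R]_(n, m)) (V : 'M[R]_(m, n)) :
  c ^+ m * \det (c%:M + U *m V) = c ^+ n * \det (c%:M + V *m U).
Proof.
pose M := block_mx c%:M (- U) V (1%:M : 'M_m).
have detM : \det M = \det (c%:M + U *m V).
  have := det_mulmx M (block_mx 1%:M 0 (- V) 1%:M).
  rewrite det_lblock !det1 !mulr1 => <-.
  rewrite mulmx_block !(mulmx1, mul1mx, mulmx0, add0r, subrr) mulNmx mulmxN opprK.
  by rewrite det_ublock det1 mulr1.
rewrite -detM -[in RHS](det_scalar n c) -(det_ublock _ (- U)) -[in LHS](det_scalar m c).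
rewrite -[X in X * _ = _]mul1r -[X in X * _ * _ = _](det1 R n) -(det_lblock _ (- V)) -det_mulmx.
rewrite mulmx_block !(mulmx1, mul1mx, mul0mx, addr0, mulmxN, mulNmx, opprK).
by rewrite mul_mx_scalar mul_scalar_mx addNr [V *m U + _]addrC.
Qed.

Lemma det_mx44 (R : comNzRingType) (M : 'M[R]_4) (m := fun i j => M (inord i) (inord j)) :
  \det M =
    m 0%N 0%N * (m 1%N 1%N * (m 2%N 2%N * m 3%N 3%N - m 2%N 3%N * m 3%N 2%N)
                 - m 1%N 2%N * (m 2%N 1%N * m 3%N 3%N - m 2%N 3%N * m 3%N 1%N)
                 + m 1%N 3%N * (m 2%N 1%N * m 3%N 2%N - m 2%N 2%N * m 3%N 1%N))
  - m 0%N 1%N * (m 1%N 0%N * (m 2%N 2%N * m 3%N 3%N - m 2%N 3%N * m 3%N 2%N)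
                 - m 1%N 2%N * (m 2%N 0%N * m 3%N 3%N - m 2%N 3%N * m 3%N 0%N)
                 + m 1%N 3%N * (m 2%N 0%N * m 3%N 2%N - m 2%N 2%N * m 3%N 0%N))
  + m 0%N 2%N * (m 1%N 0%N * (m 2%N 1%N * m 3%N 3%N - m 2%N 3%N * m 3%N 1%N)
                 - m 1%N 1%N * (m 2%N 0%N * m 3%N 3%N - m 2%N 3%N * m 3%N 0%N)
                 + m 1%N 3%N * (m 2%N 0%N * m 3%N 1%N - m 2%N 1%N * m 3%N 0%N))
  - m 0%N 3%N * (m 1%N 0%N * (m 2%N 1%N * m 3%N 2%N - m 2%N 2%N * m 3%N 1%N)
                 - m 1%N 1%N * (m 2%N 0%N * m 3%N 2%N - m 2%N 2%N * m 3%N 0%N)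
                 + m 1%N 2%N * (m 2%N 0%N * m 3%N 1%N - m 2%N 1%N * m 3%N 0%N)).
Proof.
have mE (i j : 'I_4) : M i j = m i j by rewrite /m !inord_val.
rewrite !(expand_det_row _ ord0, big_ord_recl, big_ord0) /cofactor.
rewrite !(expand_det_row _ ord0, big_ord_recl, big_ord0) /cofactor.
rewrite !(expand_det_row _ ord0, big_ord_recl, big_ord0) /cofactor.
rewrite !det_mx11 !mxE !mE /= /bump /=.
rewrite !(expr0, expr1, sqrrN, expr1n, addn0, add0n, addn1, mul1r, addr0).
by rewrite /= !(exprS, expr0); ring.
Qed.

Lemma ew_det (t a b : nat) (A : 'M[int]_(4 * t + 1)) :
  (0 < t)%N -> (a + b = 2 * t + 1)%N -> is_tournament_mx A ->
  A *m A^T = t%:Z *: (1%:M + allones) + ew_block_mx t a ew_rows ->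
  A^T *m A = t%:Z *: (1%:M + allones) + ew_block_mx t a ew_cols ->
  `|\det A| = t%:Z ^+ (2 * t) * (4 * t%:Z - 1).
Proof.
move=> t_gt0 Hab tA AAT ATA.
have rel := ew_relation t_gt0 Hab tA AAT ATA.
have t0 : t%:Z != 0 by lia.
have det4 : \det (t%:Z%:M + diag_mx (sizes t a b) *m shifted_table t ew_rows)
    = t%:Z ^+ 3 * (4 * t%:Z - 1) ^+ 2.
  have inordE i j : (i < 4)%N -> (j < 4)%N -> ((inord i : 'I_4) == inord j) = (i == j).
    by move=> ? ?; rewrite -val_eqE /= !inordK.
  rewrite det_mx44 mul_diag_mx !mxE !inordE // !inordK //=.
  have -> : b%:Z = 2 * t%:Z + 1 - a%:Z by lia.
  apply/eqP; rewrite -subr_eq0; apply/eqP.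
  (* The difference of both sides is - t^2 (4t-3) times the relation. *)
  have {}rel : (a%:Z - t%:Z) * (a%:Z - t%:Z - 1) - 2 * t%:Z = 0 by rewrite rel subrr.
  rewrite -[RHS](mulr0 (- t%:Z ^+ 2 * (4 * t%:Z - 3))) -[in RHS]rel.
  by move: t%:Z a%:Z => x y; ring.
(* The left factor t^4 comes from the four columns of [block_ind t a]; on the right, t^(4t+1) t^3 =
   t^4 t^(4t). *)
have : t%:Z ^+ 4 * \det (A *m A^T) = t%:Z ^+ 4 * (t%:Z ^+ (2 * t) * (4 * t%:Z - 1)) ^+ 2.
  rewrite AAT ew_gram_blocks det_scalar_add_mulmx mulmxA (block_ind_gram Hab) det4.
  by rewrite exprMn -exprM [LHS]mulrA [RHS]mulrA -!exprD; congr (_ ^+ _ * _); lia.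
move/mulfI => /(_ (expf_neq0 4 t0)); rewrite det_mulmx det_tr -expr2 => sq_det.
apply/eqP; rewrite -(eqrXn2 (n := 2)) // -?normrX ?sq_det; last first.
  by rewrite mulr_ge0 ?exprn_ge0 //; lia.
by rewrite ger0_norm // sqr_ge0.
Qed.

(** * Vectors annihilating A modulo q *)

Lemma dvdz_mx_scale (q : int) (m n : nat) (M : 'M[int]_(m, n)) :
  (forall i j, (q %| M i j)%Z) -> exists W : 'M[int]_(m, n), M = q *: W.
Proof.
move=> qM; exists (\matrix_(i, j) (M i j %/ q)%Z).
by apply/matrixP => i j; rewrite !mxE mulrC divzK.
Qed.

(** The pair is (y, -x) / gcd(x, y), or (1, 0) if x = y = 0. Its Bezout coefficients serve later to
    deduce q | m from q | m c and q | m d. *)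
Lemma unimodular_annihilator (x y : int) :
  exists c d u w : int, c * x + d * y = 0 /\ u * c + w * d = 1.
Proof.
have [/eqP|g_neq0] := boolP (gcdz x y == 0).
  by move=> /eqP; rewrite gcdz_eq0 => /andP[/eqP -> /eqP ->]; exists 1, 0, 1, 0; split; ring.
have [u [w uw]] := Bezoutz x y.
have /dvdzP[x' xE] := dvdz_gcdl x y; have /dvdzP[y' yE] := dvdz_gcdr x y.
move: g_neq0 uw xE yE; move: (gcdz x y) => g g_neq0 uw xE yE.
exists y', (- x'), w, (- u); split; first by rewrite xE yE; ring.
by apply: (mulIf g_neq0); rewrite mul1r -[RHS]uw xE yE; ring.
Qed.

Local Notation o_ k := (@Ordinal 4 k isT).

Lemma mulmx4E (R : pzRingType) (m : nat) (u : 'rV[R]_4) (M : 'M[R]_(4, m)) k :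
  (u *m M) 0 k = u 0 (o_ 0) * M (o_ 0) k + u 0 (o_ 1) * M (o_ 1) k
               + u 0 (o_ 2) * M (o_ 2) k + u 0 (o_ 3) * M (o_ 3) k.
Proof.
rewrite mxE !big_ord_recl big_ord0 addr0 !addrA.
by do !congr (_ + _); congr (u _ _ * M _ _); apply: val_inj.
Qed.

Lemma table_mxE m n C k l : @table_mx m n C k l = (nth [::] C k)`_l.
Proof. by rewrite mxE. Qed.

Section EWKernel.
Variables (t a b : nat) (A : 'M[int]_(4 * t + 1)).
Hypothesis t_gt0 : (0 < t)%N.
Hypothesis Hab : (a + b = 2 * t + 1)%N.
Hypothesis tA : is_tournament_mx A.
Hypothesis AAT : A *m A^T = t%:Z *: (1%:M + allones) + ew_block_mx t a ew_rows.
Hypothesis ATA : A^T *m A = t%:Z *: (1%:M + allones) + ew_block_mx t a ew_cols.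
Let E := block_ind t a.

(** Write v A = q w. As v J = 0, v A^T = - v - q w, so both v A A^T and v A^T A are multiples of q.
    The Gram matrices express them through t v and the four block sums [s] of v, which gives
    congruences modulo q between t v and [s]. *)
Lemma ew_left_kernel_mod (q : int) (v : 'rV[int]_(4 * t + 1)) :
  v *m (const_mx 1 : 'cV_(4 * t + 1)) = 0 ->
  (forall j, (q %| (v *m A) 0%R j)%Z) ->
  forall j, (q %| (4 * t%:Z + 1) * t%:Z * v 0%R j)%Z.
Proof.
move=> v1 qvA j.
have [w vA] : exists w : 'rV[int]_(4 * t + 1), v *m A = q *: w.
  by apply: dvdz_mx_scale => i k; rewrite (ord1 i).
have vAT : v *m A^T = - v - q *: w.
  have /(congr1 (mulmx v)) := tA.2; rewrite mulmxDr vA mulmxBr mulmx1.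
  have -> : v *m allones = 0 :> 'rV_(4 * t + 1).
    have -> : allones = (const_mx 1 : 'cV[int]_(4 * t + 1)) *m (const_mx 1 : 'rV_(4 * t + 1)).
      by apply/matrixP => i k; rewrite !mxE big_ord1 !mxE mulr1.
    by rewrite mulmxA v1 mul0mx.
  by rewrite sub0r => <-; rewrite [X in X - _]addrC addrK.
set s := v *m E.
have s1 : s 0 (o_ 0) + s 0 (o_ 1) + s 0 (o_ 2) + s 0 (o_ 3) = 0.
  have /matrixP/(_ 0 0) := v1; rewrite (const_blocks t a) mulmxA -/E -/s mulmx4E.
  by rewrite ![const_mx 1 _ _]mxE [X in _ = X]mxE !mulr1.
have vgram C : v *m (t%:Z *: (1%:M + allones) + ew_block_mx t a C)
    = t%:Z *: v + s *m table_mx C *m E^T.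
  rewrite ew_gram_blocks mulmxDr mul_mx_scalar !mulmxA -/E -/s; congr (_ + _ *m _).
  rewrite mulmxDr -scalemxAr [X in _ + _ *: X](_ : _ = 0) ?scaler0 ?addr0 //.
  apply/matrixP => i k; rewrite (ord1 i) mulmx4E ![allones _ _]mxE.
  by rewrite !mulr1 s1 mxE.
have eqR : t%:Z *: v + s *m table_mx ew_rows *m E^T = q *: (w *m A^T).
  by rewrite -vgram -AAT mulmxA vA scalemxAl.
have eqC : t%:Z *: v + s *m table_mx ew_cols *m E^T = - (q *: (w + w *m A)).
  rewrite -vgram -ATA mulmxA vAT mulmxBl mulNmx vA -scalemxAl.
  by rewrite scalerDr opprD.
have scE m n (c : int) (M : 'M_(m, n)) i k : (c *: M) i k = c * M i k by rewrite mxE.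
have opE m n (M : 'M[int]_(m, n)) i k : (- M) i k = - M i k by rewrite mxE.
have entR i : t%:Z * v 0 i + (s *m table_mx ew_rows) 0 (Ordinal (ew_block_lt4 t a i))
    = q * (w *m A^T) 0 i.
  have /matrixP/(_ 0 i) := eqR.
  by rewrite mxE mulmx_block_ind_tr !scE.
have entC i : t%:Z * v 0 i + (s *m table_mx ew_cols) 0 (Ordinal (ew_block_lt4 t a i))
    = - (q * (w + w *m A) 0 i).
  have /matrixP/(_ 0 i) := eqC.
  by rewrite mxE mulmx_block_ind_tr opE !scE.
have entE k : t%:Z * s 0 k + (s *m table_mx ew_rows) 0 k * sizes t a b 0 k
    = q * (w *m A^T *m E) 0 k.
  have /(congr1 (fun M => (M *m E) 0 k)) := eqR.
  rewrite mulmxDl -!scalemxAl -/s -[_ *m E]mulmxA (block_ind_gram Hab) mul_mx_diag.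
  by rewrite mxE !scE [X in _ + X = _ -> _]mxE [_ 0 k * _]mulrC.
(* Index 0 lies in block 0 because t > 0. There the row table contributes minus the total of [s],
   which is 0, and the column table s0 - s1; hence s0 = s1 modulo q. *)
have lt0 : (0 < 4 * t + 1)%N by lia.
have blk0 : Ordinal (ew_block_lt4 t a (Ordinal lt0)) = o_ 0.
  by apply: val_inj; rewrite /= /ew_block t_gt0.
have := entC (Ordinal lt0); have := entR (Ordinal lt0); rewrite blk0.
have := entE (o_ 3); have := entE (o_ 2); have := entE (o_ 0).
rewrite !mulmx4E !table_mxE [sizes _ _ _ _ (o_ 0)]mxE [sizes _ _ _ _ (o_ 2)]mxE.
rewrite [sizes _ _ _ _ (o_ 3)]mxE /=.
have := entR j; move: (Ordinal (ew_block_lt4 _ _ _)) => kj.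
rewrite !mulmx4E !table_mxE.
have ab : b%:Z = 2 * t%:Z + 1 - a%:Z by lia.
move: s1; move: (s 0 (o_ 0)) (s 0 (o_ 1)) (s 0 (o_ 2)) (s 0 (o_ 3)) => s0 s1 s2 s3.
move: ((w *m A^T) 0 j) ((w *m A^T) 0 (Ordinal lt0)) ((w + w *m A) 0 (Ordinal lt0)).
move: (v 0 j) (v 0 (Ordinal lt0)) ((w *m A^T *m E) 0 (o_ 0)).
move: ((w *m A^T *m E) 0 (o_ 2)) ((w *m A^T *m E) 0 (o_ 3)).
move=> e2 e3 vj v0 e0 y z1 z0 sum0 eqj eq0 eq2 eq3 R0 C0.
have s1E : s1 = s0 + q * (z0 + z1) by lra.
have s2E : s2 = - (s0 + s3) - s0 - q * (z0 + z1) by lra.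
(* With s1 and s2 eliminated, subtracting the sum over block 2 from the sum over block 3 leaves s0 +
   s3 with coefficient 2t + a + b = 4t + 1. *)
have sigma : (4 * t%:Z + 1) * (s0 + s3) = q * (e3 - e2 - (b%:Z + t%:Z) * (z0 + z1)).
  move: eq0 eq2 eq3; rewrite s1E s2E ab.
  by move: t%:Z a%:Z => x u; lra.
(* Modulo q, t v_j is 0 in blocks 0 and 1, s0 + s3 in block 2, and - (s0 + s3) in block 3. *)
have [c cE] : exists c, (4 * t%:Z + 1) * (t%:Z * vj) = q * c.
  case: kj eqj => [[|[|[|[|k]]]] Hk] //= eqj.
  - have -> : t%:Z * vj = q * y by lra.
    by exists ((4 * t%:Z + 1) * y); ring.
  - have -> : t%:Z * vj = q * (y - (z0 + z1)) by lra.
    by exists ((4 * t%:Z + 1) * (y - (z0 + z1))); ring.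
  - have -> : t%:Z * vj = q * y + (s0 + s3) by lra.
    rewrite mulrDr sigma.
    by exists ((4 * t%:Z + 1) * y + (e3 - e2 - (b%:Z + t%:Z) * (z0 + z1))); ring.
  - have -> : t%:Z * vj = q * (y - (z0 + z1)) - (s0 + s3) by lra.
    rewrite mulrBr sigma.
    by exists ((4 * t%:Z + 1) * (y - (z0 + z1)) - (e3 - e2 - (b%:Z + t%:Z) * (z0 + z1))); ring.
by rewrite -mulrA cE dvdz_mulr.
Qed.
End EWKernel.

(** * Regularity modulo t and rank modulo p *)

(** Substituting A^T = J - I - A in A A^T = R modulo c gives A = A J - A^2 - R, and each term on the
    right has the form A Y A: A J = A G R' = A (G A^T) A, and R = R Z R = R Z H R' = A (A^T Z H A^T)
    A. *)
Lemma regular_mod (n : nat) (c : int) (A R R' J T0 Z H G : 'M[int]_n) :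
  A *m A^T = c *: T0 + R -> A^T *m A = c *: T0 + R' -> A + A^T = J - 1%:M ->
  J = G *m R' -> R = H *m R' -> R = R *m Z *m R ->
  exists Y W : 'M[int]_n, A *m Y *m A = A + c *: W.
Proof.
move=> AAT ATA AJ defJ defR RZR.
(* Chosen so that (c T0 + R) Z H (c T0 + R') = R + c X. *)
pose X := R *m Z *m (H *m T0) + T0 *m Z *m R + c *: (T0 *m Z *m (H *m T0)).
have AA : A = A *m J - A *m A - R - c *: T0.
  have := AAT; rewrite (_ : A^T = J - 1%:M - A); last by rewrite -AJ addrC addKr.
  rewrite !mulmxBr mulmx1; move: (A *m J) (A *m A) => AJ' A2 /matrixP eqA.
  by apply/matrixP => i j; have := eqA i j; rewrite !mxE; lra.
have AGA : A *m (G *m A^T) *m A = A *m J + c *: (A *m G *m T0).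
  by rewrite -!mulmxA ATA !mulmxDr -!scalemxAr -defJ addrC !mulmxA.
have RR : A *m (A^T *m Z *m H *m A^T) *m A = R + c *: X.
  rewrite -!mulmxA ATA !mulmxA AAT -!mulmxA mulmxDr -scalemxAr -defR.
  rewrite !(mulmxDl, mulmxDr) !(=^~ scalemxAl, =^~ scalemxAr) !mulmxA -RZR /X !mulmxA.
  by apply/matrixP => i j; rewrite !(scalerDr, scalerA) ![in LHS]mxE ![in RHS]mxE; ring.
exists (- 1%:M + G *m A^T - A^T *m Z *m H *m A^T), (T0 + A *m G *m T0 - X).
rewrite mulmxBr mulmxDr mulmxBl mulmxDl mulmxN mulNmx mulmx1 AGA RR.
rewrite [X in _ = X + _]AA; clear AA AGA RR.
move: (A *m J) (A *m A) (A *m G *m T0) X => AJ' A2 AGT X'.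
by apply/matrixP => i j; rewrite !mxE; ring.
Qed.

(** R has rank m: it factors through dimension m, and the identity of size m factors through it. The
    inequality rank B + rank B^T <= n + rank (B B^T) gives one bound. For the other, the row spaces
    of B and B^T span everything and their intersection contains that of R, so the dimension formula
    applies. *)
Lemma mxrank_of_gram (F : fieldType) (n m : nat) (B R R' J H G : 'M[F]_n)
    (S : 'M[F]_(m, n)) (K : 'M[F]_m) :
  B *m B^T = R -> B^T *m B = R' -> B + B^T = J - 1%:M ->
  J = G *m R' -> R = H *m R' ->
  R = R *m S^T *m K *m (S *m R) -> S *m R *m S^T *m K = 1%:M ->
  (\rank B + \rank B = n + m)%N.
Proof.
move=> BBT BTB BJ defJ defR RSR SRS.
have rankR : \rank R = m.
  apply/eqP; rewrite eqn_leq; apply/andP; split.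
    by rewrite RSR (leq_trans (mxrankM_maxr _ _)) // rank_leq_row.
  rewrite -[X in (X <= _)%N](mxrank1 F m) -SRS -!mulmxA (leq_trans (mxrankM_maxr _ _)) //.
  exact: mxrankM_maxl.
have sJB : (J <= B)%MS by rewrite defJ -BTB mulmxA submxMl.
have sRB : (R <= B)%MS by rewrite defR -BTB mulmxA submxMl.
have sRBT : (R <= B^T)%MS by rewrite -BBT submxMl.
apply/eqP; rewrite eqn_leq; apply/andP; split.
  have := mxrank_mul_min B B^T; rewrite BBT rankR mxrank_tr; lia.
rewrite -[X in (_ <= _ + X)%N]mxrank_tr -mxrank_sum_cap leq_add //; last first.
  by rewrite -rankR mxrankS // sub_capmx sRB.
rewrite -[X in (X <= _)%N](mxrank1 F n) mxrankS //.
have -> : 1%:M = J - B - B^T.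
  by rewrite -addrA -opprD BJ opprB addrC subrK.
apply: addmx_sub; last by rewrite eqmx_opp addsmxSr.
apply: addmx_sub; last by rewrite eqmx_opp addsmxSl.
exact: submx_trans sJB (addsmxSl _ _).
Qed.

(** * Factorization of the tables through three rows *)

(** Products of concrete tables are computed on lists, so that [vm_compute] decides matrix
    identities. *)
Definition table_mul (m n p : nat) (C D : seq (seq int)) : seq (seq int) :=
  mkseq (fun i => mkseq (fun j =>
    foldr +%R 0 (mkseq (fun k => (nth [::] C i)`_k * (nth [::] D k)`_j) n)) p) m.

Definition table_tr (m n : nat) (C : seq (seq int)) : seq (seq int) :=
  mkseq (fun i => mkseq (fun j => (nth [::] C j)`_i) m) n.

Lemma mulmx_table (m n p : nat) C D :
  @table_mx m n C *m @table_mx n p D = table_mx (table_mul m n p C D).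
Proof.
apply/matrixP => i j; rewrite !mxE !nth_mkseq //; try exact: ltn_ord.
rewrite foldrE big_map -[n in iota _ n]subn0 big_mkord.
by apply: eq_bigr => k _; rewrite !mxE.
Qed.

Lemma trmx_table (m n : nat) C : (@table_mx m n C)^T = table_mx (table_tr m n C).
Proof. by apply/matrixP => i j; rewrite !mxE !nth_mkseq. Qed.

(* The table rows of one index from each of the blocks 0, 1 and l; l = 2 unless
   block 2 is empty (a = 0), and then l = 3. *)
Definition reps (l : nat) : 'M[int]_(3, 4) :=
  table_mx [:: [:: 1]; [:: 0; 1]; [:: 0; 0; (l == 2)%:R; (l == 3)%:R]].

Lemma block_reps (t a b : nat) : (0 < t)%N -> (a + b = 2 * t + 1)%N ->
  exists S : 'M[int]_(3, 4 * t + 1),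
  exists l, l \in [:: 2; 3]%N /\ S *m block_ind t a = reps l.
Proof.
move=> t_gt0 Hab.
have lt k : (nth 0%N [:: 0; t; t + t]%N k < 4 * t + 1)%N.
  by case: k => [|[|[|[|k]]]] /=; lia.
exists (rowsub (fun k : 'I_3 => Ordinal (lt k)) 1%:M), (if (0 < a)%N then 2 else 3)%N.
split; first by case: ifP.
rewrite -rowsubE; apply/matrixP => -[[|[|[|k]]] Hk] -[[|[|[|[|m]]]] Hm] //;
  rewrite !mxE /= /ew_block.
all: rewrite ?t_gt0 // ?ltnn.
all: do 6?[case: ifP => // ?]; lia.
Qed.

(** Inverse of the submatrix of [ew_rows] on the indices 0, 1, l. Both values of l give the same
    submatrix, of determinant -1, so its inverse is integral. *)
Definition reps_gram_inv : 'M[int]_3 :=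
  table_mx [:: [:: 0; 0; -1]; [:: 0; 1; -1]; [:: -1; -1; 2]].

Lemma scalar_table3 : 1%:M = table_mx [:: [:: 1; 0; 0]; [:: 0; 1; 0]; [:: 0; 0; 1]] :> 'M_3.
Proof.
by apply/matrixP => -[[|[|[|i]]] Hi] -[[|[|[|j]]] Hj] //; rewrite !mxE.
Qed.

Lemma allones_table4 : allones = table_mx (nseq 4 (nseq 4 1)) :> 'M_4.
Proof.
by apply/matrixP => -[[|[|[|[|i]]]] Hi] -[[|[|[|[|j]]]] Hj] //; rewrite !mxE.
Qed.

Lemma reps_tables l : l \in [:: 2; 3]%N ->
  let C := table_mx ew_rows in let F := reps l in
  [/\ C = C *m F^T *m reps_gram_inv *m (F *m C),
      F *m C *m F^T *m reps_gram_inv = 1%:M,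
      exists T, C = T *m (F *m table_mx ew_cols)
    & exists T, allones = T *m (F *m table_mx ew_cols) :> 'M_4].
Proof.
move=> Hl; rewrite /= /reps /reps_gram_inv scalar_table3 allones_table4 !trmx_table.
rewrite !mulmx_table; split.
- by congr table_mx; case/or3P: Hl => // /eqP -> //; vm_compute.
- by congr table_mx; case/or3P: Hl => // /eqP -> //; vm_compute.
(* If c0, ..., c3 are the rows of [ew_cols], those of [ew_rows] are c1, - c0, c2 - c0, c3 - c0; the
   relation c0 + c1 = c2 + c3 eliminates the row omitted by [reps l]. *)
- exists (table_mx (if l == 2 then [:: [:: 0; 1]; [:: -1]; [:: -1; 0; 1]; [:: 0; 1; -1]]
          else [:: [:: 0; 1]; [:: -1]; [:: 0; 1; -1]; [:: -1; 0; 1]])).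
  rewrite mulmx_table.
  by congr table_mx; case/or3P: Hl => // /eqP -> //; vm_compute.
(* Row 1 of [ew_cols] is constantly -1. *)
- exists (table_mx (nseq 4 [:: 0; -1])).
  by rewrite mulmx_table; congr table_mx; case/or3P: Hl => // /eqP -> //; vm_compute.
Qed.

(** The table identities carry over because S E = F. All factors are integral, so they serve both
    modulo t and modulo its prime divisors. *)
Lemma ew_block_mx_factor (t a b : nat) : (0 < t)%N -> (a + b = 2 * t + 1)%N ->
  let R := ew_block_mx t a ew_rows in let R' := ew_block_mx t a ew_cols in
  exists (S : 'M[int]_(3, 4 * t + 1)) (K : 'M[int]_3) (H G : 'M[int]_(4 * t + 1)),
  [/\ R = R *m S^T *m K *m (S *m R), S *m R *m S^T *m K = 1%:M,
      R = H *m R' & allones = G *m R'].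
Proof.
move=> t_gt0 Hab R R'; have [S [l [Hl SE]]] := block_reps t_gt0 Hab.
have [eq1 eq2 [T eqT] [T' eqT']] := reps_tables Hl.
set E := block_ind t a in SE; set F := reps l in SE eq1 eq2 eqT eqT'.
have SX (m : nat) (M : 'M_(4, m)) : S *m (E *m M) = F *m M by rewrite mulmxA SE.
have XS (m : nat) (M : 'M_(m, 4)) : M *m E^T *m S^T = M *m F^T.
  by rewrite -mulmxA -trmx_mul SE.
exists S, reps_gram_inv, (E *m T *m S), (E *m T' *m S).
rewrite (allones_blocks t a) /R /R' !ew_block_mx_table -/E; split.
- by rewrite XS -[E *m _ *m E^T]mulmxA SX {1}eq1 !mulmxA.
- by rewrite -(mulmxA E) SX mulmxA XS.
- by rewrite -!mulmxA SX {1}eqT !mulmxA.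
- by rewrite -!mulmxA SX {1}eqT' !mulmxA.
Qed.

Lemma ew_regular_mod (t a b : nat) (A : 'M[int]_(4 * t + 1)) :
  (0 < t)%N -> (a + b = 2 * t + 1)%N -> is_tournament_mx A ->
  A *m A^T = t%:Z *: (1%:M + allones) + ew_block_mx t a ew_rows ->
  A^T *m A = t%:Z *: (1%:M + allones) + ew_block_mx t a ew_cols ->
  exists Y W : 'M[int]_(4 * t + 1), A *m Y *m A = A + t%:Z *: W.
Proof.
move=> t_gt0 Hab tA AAT ATA.
have [S [K [H [G [RSR _ RH JG]]]]] := ew_block_mx_factor t_gt0 Hab.
apply: (regular_mod AAT ATA tA.2 JG RH (Z := S^T *m K *m S)).
by rewrite {1}RSR !mulmxA.
Qed.

Lemma ew_mxrank_modp (t a b p : nat) (A : 'M[int]_(4 * t + 1)) :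
  (0 < t)%N -> (a + b = 2 * t + 1)%N -> is_tournament_mx A ->
  A *m A^T = t%:Z *: (1%:M + allones) + ew_block_mx t a ew_rows ->
  A^T *m A = t%:Z *: (1%:M + allones) + ew_block_mx t a ew_cols ->
  prime p -> (p %| t)%N ->
  \rank (map_mx (intr : int -> 'F_p) A) = (2 * t + 2)%N.
Proof.
move=> t_gt0 Hab tA AAT ATA p_pr p_t.
have [S [K [H [G [RSR SRS RH JG]]]]] := ew_block_mx_factor t_gt0 Hab.
pose f := map_mx (intr : int -> 'F_p).
have t0 : (t%:Z)%:~R = 0 :> 'F_p.
  by apply/eqP; rewrite -[_%:~R]/(t%:R) -(dvdn_pcharf (pchar_Fp p_pr)).
have f_gram M (X : 'M[int]_(4 * t + 1)) : map_mx intr (t%:Z *: M + X) = f _ _ X.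
  by rewrite map_mxD map_mxZ /= t0 scale0r add0r.
have := @mxrank_of_gram 'F_p _ 3 (f _ _ A) (f _ _ (ew_block_mx t a ew_rows))
  (f _ _ (ew_block_mx t a ew_cols)) (f _ _ allones) (f _ _ H) (f _ _ G) (f _ _ S) (f _ _ K).
rewrite /f !matrix.map_trmx -!map_mxM -!map_mxD AAT ATA tA.2 !f_gram.
rewrite -RSR -RH -JG SRS map_mxB !map_mx1 => /(_ erefl erefl erefl erefl erefl erefl erefl) rr.
set r := \rank _; have {}rr : (r + r = 4 * t + 1 + 3)%N by exact: rr.
lia.
Qed.

(** * Determinant, regularity and ranks read off a Smith form *)

Section Smith.
Variables (n : nat) (L R : 'M[int]_n) (d : seq int).
Hypotheses (Lu : L \in unitmx) (Ru : R \in unitmx) (d_sorted : sorted dvdz d).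
Variable A : 'M[int]_n.
Hypothesis defA : A = L *m diag_mx (\row_(i < n) d`_i) *m R.

Lemma sorted_dvdz_nth i j : (i <= j)%N -> (d`_i %| d`_j)%Z.
Proof.
(* Entries past the end of [d] read as 0, which everything divides. *)
move=> le_ij; have [lt_j|/(nth_default 0) ->] := ltnP j (size d); last exact: dvdz0.
apply: (sorted_leq_nth _ _ _ d_sorted) => //; last exact: leq_ltn_trans lt_j.
- by move=> ? ? ?; apply: dvdz_trans.
- exact: dvdzz.
Qed.

Lemma Smith_det : `|\det A| = \prod_(i < n) `|d`_i|.
Proof.
have unit_norm (M : 'M[int]_n) : M \in unitmx -> `|\det M| = 1.
  by rewrite unitmxE => /orP[] /eqP ->; rewrite ?normrN normr1.
rewrite defA !det_mulmx !normrM (unit_norm L) // (unit_norm R) // mul1r mulr1 det_diag normr_prod.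
by apply: eq_bigr => i _; rewrite mxE.
Qed.

(** Cancelling L and R turns the hypothesis into D M D = D modulo c with M = R Y L; z is the
    diagonal entry M_ii. *)
Lemma Smith_regular c (Y W : 'M[int]_n) : A *m Y *m A = A + c *: W ->
  forall i : 'I_n, exists z, (c %| d`_i * (d`_i * z - 1))%Z.
Proof.
move=> AYA i; pose D := diag_mx (\row_(i < n) d`_i).
have eqD : D *m (R *m Y *m L) *m D = D + c *: (invmx L *m W *m invmx R).
  apply: (can_inj (mulKmx Lu)); apply: (can_inj (mulmxK Ru)).
  rewrite mulmxDr mulmxDl -defA -scalemxAr -scalemxAl !mulmxA.
  by rewrite mulmxV // mul1mx mulmxKV // -AYA defA !mulmxA.
exists ((R *m Y *m L) i i); have /matrixP/(_ i i) := eqD.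
rewrite /D mul_mx_diag mul_diag_mx; move: (R *m Y *m L) (invmx L *m W *m invmx R) => M N.
rewrite !mxE eqxx mulr1n => eqi.
apply/dvdzP; exists (N i i).
by rewrite mulrBr mulr1 mulrA mulrAC eqi; ring.
Qed.

(** Modulo p the diagonal vanishes from index k on, so D factors through dimension k. *)
Lemma Smith_rank_le p k : prime p -> (p%:Z %| d`_k)%Z ->
  (\rank (map_mx (intr : int -> 'F_p) A) <= k)%N.
Proof.
move=> p_pr p_dk.
have p0 i : (k <= i)%N -> (d`_i)%:~R = 0 :> 'F_p.
  move=> /sorted_dvdz_nth /(dvdz_trans p_dk).
  by rewrite (dvdz_pcharf (pchar_Fp p_pr)) => /eqP.
rewrite defA !map_mxM -mulmxA (leq_trans (mxrankM_maxr _ _)) // (leq_trans (mxrankM_maxl _ _)) //.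
rewrite map_diag_mx.
set D := diag_mx _; have -> : D = D *m (pid_mx k : 'M_(n, k)) *m (pid_mx k : 'M_(k, n)).
  rewrite -mulmxA mul_pid_mx minnn minnn mul_diag_mx; apply/matrixP => i j.
  rewrite !mxE /=; case: ltnP => [_|/p0 ->]; last by rewrite mul0rn mul0r.
  by rewrite andbT val_eqE mulr_natr.
exact: leq_trans (mxrankM_maxl _ _) (rank_leq_col _).
Qed.

(** The first k + 1 diagonal entries are invertible modulo p; multiplying by their inverses [e]
    yields a projection of rank k + 1. *)
Lemma Smith_rank_ge p k : prime p -> (k < n)%N -> ~~ (p%:Z %| d`_k)%Z ->
  (k < \rank (map_mx (intr : int -> 'F_p) A))%N.
Proof.
move=> p_pr lt_kn p_dk.
have p1 i : (i <= k)%N -> (d`_i)%:~R != 0 :> 'F_p.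
  move=> /sorted_dvdz_nth dik; rewrite -(dvdz_pcharf (pchar_Fp p_pr)).
  by apply: contra p_dk => /dvdz_trans; apply.
pose D : 'M[int]_n := diag_mx (\row_(i < n) d`_i).
have defD : D = invmx L *m A *m invmx R by rewrite defA !mulmxA mulVmx // mul1mx mulmxK.
have rankD : (\rank (map_mx (intr : int -> 'F_p) D) <= \rank (map_mx (intr : int -> 'F_p) A))%N.
  rewrite defD !map_mxM (leq_trans (mxrankM_maxl _ _)) //.
  exact: mxrankM_maxr.
apply: leq_trans rankD; rewrite map_diag_mx -[X in (X <= _)%N](@rank_pid_mx 'F_p n n) //.
pose e : 'rV['F_p]_n := \row_i (if (i <= k)%N then ((d`_i)%:~R)^-1 else 0).
have -> : pid_mx k.+1 = diag_mx e *m diag_mx (map_mx intr (\row_(i < n) d`_i)).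
  rewrite mul_diag_mx; apply/matrixP => i j; rewrite !mxE ltnS val_eqE /=.
  case: leqP => [/p1 dk|_]; last by rewrite andbF mul0r.
  by rewrite andbT mulrnAr mulVf.
exact: mxrankM_maxr.
Qed.
End Smith.

(** * The invariant factors of A *)

(** The condition v j = 0 costs one degree of freedom, so two rows of L^-1 are combined; this is why
    the last but one factor is bounded and not the last. *)
Lemma ew_Smith_dvd (t a b : nat) (A L R : 'M[int]_(4 * t + 1)) (d : seq int) :
  (0 < t)%N -> (a + b = 2 * t + 1)%N -> is_tournament_mx A ->
  A *m A^T = t%:Z *: (1%:M + allones) + ew_block_mx t a ew_rows ->
  A^T *m A = t%:Z *: (1%:M + allones) + ew_block_mx t a ew_cols ->
  L \in unitmx -> sorted dvdz d ->
  A = L *m diag_mx (\row_(i < 4 * t + 1) d`_i) *m R ->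
  (d`_(4 * t - 1) %| (4 * t%:Z + 1) * t%:Z)%Z.
Proof.
move=> t_gt0 Hab tA AAT ATA Lu d_sorted defA.
have lt1 : (4 * t - 1 < 4 * t + 1)%N by lia.
have lt2 : (4 * t < 4 * t + 1)%N by lia.
set q := d`_ _; pose i1 := Ordinal lt1; pose i2 := Ordinal lt2.
have neq12 : i1 != i2 by rewrite -val_eqE /=; lia.
pose j1 : 'cV[int]_(4 * t + 1) := const_mx 1.
have [c1 [c2 [u1 [u2 [c0 uc]]]]] :=
  unimodular_annihilator ((invmx L *m j1) i1 0) ((invmx L *m j1) i2 0).
pose e : 'rV[int]_(4 * t + 1) := c1 *: delta_mx 0 i1 + c2 *: delta_mx 0 i2.
pose v := e *m invmx L.
have rowE (M : 'M[int]_(4 * t + 1)) j : (e *m M) 0 j = c1 * M i1 j + c2 * M i2 j.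
  by rewrite mulmxDl -!scalemxAl -!rowE !mxE.
have v1 : v *m j1 = 0.
  apply/matrixP => i j; rewrite (ord1 i) (ord1 j) -mulmxA [RHS]mxE -c0.
  by rewrite mulmxDl -!scalemxAl -!matrix.rowE !mxE.
have qvA j : (q %| (v *m A) 0%R j)%Z.
  rewrite defA !mulmxA mulmxKV // -mulmxA rowE mul_diag_mx !mxE.
  by rewrite rpredD // dvdz_mull // dvdz_mulr // sorted_dvdz_nth //= ; lia.
have qv := ew_left_kernel_mod t_gt0 Hab tA AAT ATA v1 qvA.
(* Multiplication by L turns v back into e, whose two entries c1 and c2 are coprime. *)
have qe j : (q %| (4 * t%:Z + 1) * t%:Z * e 0%R j)%Z.
  have -> : e = v *m L by rewrite mulmxKV.
  rewrite mxE mulr_sumr; apply: (big_ind (fun x => (q %| x)%Z)) => [|x y|k _].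
  - exact: dvdz0.
  - exact: rpredD.
  - by rewrite mulrA dvdz_mulr.
have e1 : e 0 i1 = c1.
  by rewrite !mxE !eqxx (negPf neq12) mulr1 mulr0 addr0.
have e2 : e 0 i2 = c2.
  by rewrite !mxE !eqxx eq_sym (negPf neq12) mulr1 mulr0 add0r.
rewrite -[X in (_ %| X)%Z]mulr1 -[X in _ * X]uc mulrDr rpredD // mulrCA dvdz_mull //.
  by rewrite -e1 qe.
by rewrite -e2 qe.
Qed.

Lemma coprimez_ew_det (t : nat) :
  coprimez (4 * t%:Z + 1) (t%:Z ^+ (2 * t) * (4 * t%:Z - 1)).
Proof.
rewrite coprimezMr coprimezXr /=.
  by apply/coprimezP; exists (- (2 * t%:Z - 1), 2 * t%:Z) => /=; ring.
by apply/coprimezP; exists (1, - 4) => /=; ring.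
Qed.

Lemma prime_dvd_of_not_coprime (m n : nat) : (0 < m)%N ->
  ~~ coprime m n -> exists2 p, prime p & (p %| m)%N && (p %| n)%N.
Proof.
move=> m_gt0 ncop; exists (pdiv (gcdn m n)).
  by rewrite pdiv_prime // ltn_neqAle eq_sym ncop gcdn_gt0 m_gt0.
by rewrite -dvdn_gcd pdiv_dvd.
Qed.

Lemma ew_invariant_factors (t a b : nat) (A L R : 'M[int]_(4 * t + 1)) (d : seq int) :
  (0 < t)%N -> (a + b = 2 * t + 1)%N -> is_tournament_mx A ->
  A *m A^T = t%:Z *: (1%:M + allones) + ew_block_mx t a ew_rows ->
  A^T *m A = t%:Z *: (1%:M + allones) + ew_block_mx t a ew_cols ->
  L \in unitmx -> R \in unitmx -> sorted dvdz d ->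
  A = L *m diag_mx (\row_(i < 4 * t + 1) d`_i) *m R ->
  forall i, (i < 4 * t + 1)%N ->
  `|d`_i| = (nseq (2 * t + 2) 1 ++ nseq (2 * t - 2) t%:Z
               ++ [:: t%:Z ^+ 2 * (4 * t%:Z - 1)])`_i.
Proof.
move=> t_gt0 Hab tA AAT ATA Lu Ru sd defA.
have detA := ew_det t_gt0 Hab tA AAT ATA.
have prod_d := Smith_det Lu Ru defA; rewrite detA in prod_d.
have mono := sorted_dvdz_nth sd.
have rankA p := ew_mxrank_modp t_gt0 Hab tA AAT ATA (p := p).
have dvd_t i : (i < 4 * t)%N -> (d`_i %| t%:Z)%Z.
  move=> lt_i; apply: (dvdz_trans (mono _ (4 * t - 1)%N _)); first by lia.
  have := ew_Smith_dvd t_gt0 Hab tA AAT ATA Lu sd defA.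
  rewrite Gauss_dvdzr // coprimez_sym.
  have lt1 : (4 * t - 1 < 4 * t + 1)%N by lia.
  apply: (coprimez_dvdr _ (coprimez_ew_det t)).
  by rewrite prod_d (bigD1 (Ordinal lt1)) //=; apply: dvdz_mulr; rewrite dvdzE absz_id.
have d_neq0 i : (i < 4 * t)%N -> d`_i != 0.
  by move=> /dvd_t; apply: contraL => /eqP ->; rewrite dvd0z; lia.
(* A prime dividing such a d_i divides both t and d_(2t+1), so the rank modulo it would be at most
   2t + 1. *)
have low i : (i < 2 * t + 2)%N -> `|d`_i| = 1.
  move=> lt_i; have lt_i' : (i < 4 * t)%N by lia.
  apply/eqP/contraT => ne1.
  have gt1 : (1 < absz (d`_i)%R)%N by have := d_neq0 _ lt_i'; lia.
  have p_pr := pdiv_prime gt1; set p := pdiv _ in p_pr.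
  have p_di : (p%:Z %| d`_i)%Z by rewrite dvdzE /= pdiv_dvd.
  have p_t : (p %| t)%N by have := dvdz_trans p_di (dvd_t _ lt_i'); rewrite dvdzE.
  have le_i : (i <= 2 * t + 1)%N by lia.
  have := Smith_rank_le sd defA p_pr (dvdz_trans p_di (mono _ _ le_i)).
  rewrite (rankA _ p_pr p_t); lia.
(* It suffices that t is prime to d_i z - 1. A common prime p divides d_(2t+2), as the rank modulo p
   would otherwise exceed 2t + 2; so p divides d_i, and then 1. *)
have t_dvd i : (2 * t + 2 <= i < 4 * t + 1)%N -> (t%:Z %| d`_i)%Z.
  move=> /andP[le_i lt_i].
  have [Y [W AYA]] := ew_regular_mod t_gt0 Hab tA AAT ATA.
  have [z] := Smith_regular Lu Ru defA AYA (Ordinal lt_i).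
  rewrite Gauss_dvdzl // coprimezE; apply/contraT => /(prime_dvd_of_not_coprime t_gt0).
  case=> p p_pr /andP[p_t p_z].
  have p_d : (p%:Z %| d`_(2 * t + 2))%Z.
    apply/contraT => /(Smith_rank_ge Lu Ru sd defA p_pr) H.
    by have := H ltac:(lia); rewrite (rankA _ p_pr p_t) ltnn.
  have p_di := dvdz_trans p_d (mono _ _ le_i).
  have : (p%:Z %| d`_i * z - (d`_i * z - 1))%Z by rewrite rpredB // dvdz_mulr.
  by rewrite opprB addrC subrK dvdzE /= dvdn1 => /eqP p1; rewrite p1 in p_pr.
have mid i : (2 * t + 2 <= i < 4 * t)%N -> `|d`_i| = t%:Z.
  move=> Hi; have H1 : (d`_i %| t%:Z)%Z by apply: dvd_t; lia.
  have H2 : (t%:Z %| d`_i)%Z by apply: t_dvd; lia.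
  by apply/eqP; rewrite -abszE eqz_nat eqn_dvd; apply/andP; split.
have last : `|d`_(4 * t)| = t%:Z ^+ 2 * (4 * t%:Z - 1).
  have t0 : t%:Z != 0 by lia.
  apply: (mulfI (expf_neq0 (2 * t - 2) t0)); rewrite mulrA -exprD.
  have -> : (2 * t - 2 + 2 = 2 * t)%N by lia.
  rewrite prod_d -(big_mkord xpredT (fun i => `|d`_i|)) addn1 big_nat_recr //=.
  congr (_ * _); rewrite (big_cat_nat (n := (2 * t + 2)%N)) //=; last by lia.
  rewrite big_nat big1 => [|i Hi]; last by rewrite low.
  rewrite mul1r (eq_big_nat _ _ mid) prodr_const_nat; congr (_ ^+ _); lia.
move=> i Hi; rewrite !nth_cat !size_nseq !nth_nseq.
case: ltnP => [/low //|le_i]; case: ltnP => lt_i; first by apply: mid; lia.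
have -> : i = (4 * t)%N by lia.
by have -> : (4 * t - (2 * t + 2) - (2 * t - 2) = 0)%N by lia.
Qed.

Theorem theorem8p1 (t : nat) (A : 'M[int]_(4 * t + 1)) :
  (0 < t)%N ->
  is_EW_tournament_mx A ->
  is_Smith_normal_form A
    (diag_of_seq (4 * t + 1)
       (nseq (2 * t + 2) 1 ++ nseq (2 * t - 2) t%:Z
          ++ [:: t%:Z ^+ 2 * (4 * t%:Z - 1)])).
Proof.
move=> t_gt0 [tA [a [le_a AAT ATA]]].
have Hab : (a + (2 * t + 1 - a) = 2 * t + 1)%N by lia.
have [L Lu [R Ru [d sd defA]]] := int_Smith_normal_form A.
rewrite (_ : (\matrix_(i, j) _) = diag_mx (\row_(i < 4 * t + 1) d`_i)) in defA; last first.
  by apply/matrixP => i j; rewrite !mxE.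
have inv := ew_invariant_factors t_gt0 Hab tA AAT ATA Lu Ru sd defA.
set D := diag_of_seq _ _.
have DE i : D i i = `|d`_i| by rewrite !mxE eqxx mulr1n -inv.
split.
- by apply/is_diag_mxP => i j nij; rewrite !mxE -val_eqE /= (negPf nij).
- by move=> i; rewrite DE.
- move=> i j ij; rewrite !DE dvdzE !absz_id.
  by have := sorted_dvdz_nth sd (leqnSn i); rewrite ij.
(* The d_i are known up to sign; the signs go into the left unimodular factor. *)
- pose s : 'rV[int]_(4 * t + 1) := \row_i (-1) ^+ (d`_i < 0)%R.
  exists (diag_mx s *m invmx L), (invmx R); split.
  + rewrite unitmx_mul unitmx_inv Lu andbT.
    suff /mulmx1_unit[] : diag_mx s *m diag_mx s = 1%:M by [].
    by apply/matrixP => i j; rewrite mul_diag_mx !mxE mulrnAr -expr2 sqrr_sign.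
  + by rewrite unitmx_inv.
  + rewrite defA -!mulmxA mulmxV // mulmx1 mulKmx //.
    apply/matrixP => i j; rewrite mul_diag_mx !mxE -inv // mulrnAr.
    by rewrite normrEsign.
Qed.
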